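(* Let $X_1,X_2,\dots$ be independent integer-valued random variables with common distribution $F$, not concentrated on a half-axis, and let $S_0=0$, $S_n=X_1+\cdots+X_n$. Suppose $\mathbb E[X_1]<0$ and that for some $0<\xi<1$ and $0<r<1$, \[ P(X_1\ge x)=\xi\, r^x,\qquad x=0,1,2,\dots. \] Let $p=P(\sup_{n}S_n>0)$. Then $p<1$ and \[ P\Big(\sup_{n\ge0}S_n>x\Big)=p\,\big[1-(1-p)(1-r)\big]^x,\qquad x=0,1,2,\dots. \] Moreover, $1/[1-(1-p)(1-r)]$ is the unique root of the equation \[ \sum_{x=-\infty}^{\infty}s^x P(X_1=x)=1 \] in the range $1<s<1/r$. *)

(* Defs.v *)
From HB Require Import structures.
From mathcomp Require Import all_boot all_order all_algebra.
From mathcomp Require Import all_classical all_reals all_analysis.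
Set Implicit Arguments. Unset Strict Implicit. Unset Printing Implicit Defensive.
Import Order.TTheory GRing.Theory Num.Theory.
Local Open Scope classical_set_scope.
Local Open Scope ring_scope.

Definition mutually_independent d (T : measurableType d) (R : realType)
  (P : probability T R) (X : nat -> T -> R) : Prop :=
  forall (s : seq nat) (B : nat -> set R),
    uniq s -> (forall i, measurable (B i)) ->
    P (\bigcap_(i in [set` s]) (X i @^-1` B i)) =
    (\prod_(i <- s) P (X i @^-1` B i))%E.

Definition identically_distributed d (T : measurableType d) (R : realType)
  (P : probability T R) (X : nat -> T -> R) : Prop :=
  forall n (B : set R), measurable B -> P (X n @^-1` B) = P (X 0%N @^-1` B).

(* Random walk S_n = X_1 + ... + X_n (indices shifted: X 0 is X_1), S_0 = 0. *)
Definition walk (T : Type) (R : realType) (X : nat -> T -> R) (n : nat) (t : T) : R :=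
  \sum_(i < n) X i t.

Definition zsum (R : realType) (f : int -> \bar R) : \bar R :=
  (\sum_(0 <= k <oo) f (k%:Z) + \sum_(0 <= k <oo) f (- (k.+1)%:Z)%R)%E.

(* Main.v *)
Require Import Defs.
From HB Require Import structures.
From mathcomp Require Import all_boot all_order all_algebra.
From mathcomp Require Import all_classical all_reals all_analysis.
From mathcomp Require Import measurable_realfun.
From mathcomp Require Import ring lra zify.
Import Order.TTheory GRing.Theory Num.Theory numFieldNormedType.Exports.
Local Open Scope classical_set_scope.
Local Open Scope ring_scope.

(* Put q = 1/s, N_k = P(X_1 <= -(k+1)) and W(q) = sum_k N_k q^k. Since the right
   tail is geometric, Abel summation turns E s^X_1 = 1 into (q - r) W(q) = xi r,
   whose left-hand side is strictly increasing on (r, 1); it exceeds xi r near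
   q = 1 because E X_1 < 0 means sum_k N_k > sum_(k >= 1) xi r^k. So there is
   exactly one root q in (r, 1).
   The function u(x) = P(sup S_n > x) is the limit of the iterates, started at 0,
   of u(x) = P(X_1 > x) + sum_(j >= 0) P(X_1 = x - j) u(j). A direct computation
   shows that h(x) = (q - r)/(1 - r) q^x is a solution; hence u <= h, so u tends
   to 0, and the maximum principle applied to h - u gives u = h. Evaluating at
   x = 0 yields p = (q - r)/(1 - r), i.e. q = 1 - (1 - p)(1 - r). *)

(** * The power series of the left tail *)

Section tail_series.
Variables (R : realType) (N : R^nat).
Hypothesis N_ge0 : forall k, 0 <= N k.
Hypothesis N_le1 : forall k, N k <= 1.
Hypothesis N_noninc : forall k, N k.+1 <= N k.

Definition tail_term (q : R) : R^nat := fun k => N k * q ^+ k.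
Definition tail_gf (q : R) : R := limn (series (tail_term q)).

Lemma tail_term_ge0 q k : 0 <= q -> 0 <= tail_term q k.
Proof. by move=> q0; rewrite mulr_ge0 ?exprn_ge0. Qed.

Lemma is_cvg_tail_gf q : 0 <= q < 1 -> cvgn (series (tail_term q)).
Proof.
move=> /andP[q0 q1].
apply: (@series_le_cvg _ _ (geometric 1 q)).
- by move=> k; exact: tail_term_ge0.
- by move=> k; rewrite /= mul1r exprn_ge0.
- by move=> k; rewrite /= ler_wpM2r ?exprn_ge0.
- by apply: is_cvg_geometric_series; rewrite ger0_norm.
Qed.

Lemma tail_gf_ge_series q n : 0 <= q < 1 -> series (tail_term q) n <= tail_gf q.
Proof.
move=> q01; apply: nondecreasing_cvgn_le; last exact: is_cvg_tail_gf.
apply: nondecreasing_series => k _ _; apply: tail_term_ge0.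
by case/andP: q01.
Qed.

Lemma tail_gf_ge_N0 q : 0 <= q < 1 -> N 0%N <= tail_gf q.
Proof.
move=> /(tail_gf_ge_series _ 1%N).
by rewrite /series/= big_nat1 /tail_term expr0 mulr1.
Qed.

Lemma ler_tail_gf q q' : 0 <= q -> q <= q' -> q' < 1 -> tail_gf q <= tail_gf q'.
Proof.
move=> q0 qq' q'1; apply: lim_series_le.
- by apply: is_cvg_tail_gf; rewrite q0 (le_lt_trans qq').
- by apply: is_cvg_tail_gf; rewrite q'1 (le_trans q0).
- move=> k; rewrite ler_wpM2l// lerXn2r// nnegrE//.
  exact: le_trans qq'.
Qed.

(** Summation by parts on the partial sums; the boundary term [N n * q ^+ n] is the general term of
    a convergent series, so it vanishes. For left tails [N], the series on the left is the part of E
    s^X with X < 0, at s = 1/q. *)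
Lemma tail_gf_abel q : 0 <= q < 1 ->
  series (fun k => q ^+ k.+1 * (N k - N k.+1)) @ \oo -->
    N 0%N - (1 - q) * tail_gf q.
Proof.
move=> q01; have /andP[q0 q1] := q01.
have E n : series (fun k => q ^+ k.+1 * (N k - N k.+1)) n =
    N 0%N - (1 - q) * series (tail_term q) n - tail_term q n.
  elim: n => [|n IH].
    by rewrite /series/= !big_nil /tail_term expr0; ring.
  rewrite !seriesSr IH /tail_term !exprS; ring.
rewrite (_ : series _ = fun n => N 0%N - (1 - q) * series (tail_term q) n
    - tail_term q n); last by apply/funext.
rewrite -[X in _ --> X]subr0.
have c := is_cvg_tail_gf q q01.
apply: cvgB; last exact: cvg_series_cvg_0 c.
by apply: cvgB; [exact: cvg_cst|apply: cvgMr].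
Qed.

(* By Abel summation, (1 - q) W(q) = N 0 - sum_k q^(k+1) (N k - N (k+1)). *)
Lemma ger_onem_tail_gf q q' : 0 <= q -> q <= q' -> q' < 1 ->
  (1 - q') * tail_gf q' <= (1 - q) * tail_gf q.
Proof.
move=> q0 qq' q'1.
have q01 : 0 <= q < 1 by rewrite q0 (le_lt_trans qq').
have q'01 : 0 <= q' < 1 by rewrite q'1 (le_trans q0).
have [c c'] := (tail_gf_abel q q01, tail_gf_abel q' q'01).
rewrite -(lerD2l (- N 0%N)) -lerN2 !opprD !opprK.
rewrite -(cvg_lim (@Rhausdorff R) c) -(cvg_lim (@Rhausdorff R) c').
apply: lim_series_le; [exact: cvgP c|exact: cvgP c'|].
move=> k; rewrite ler_wpM2r ?subr_ge0// lerXn2r// nnegrE//.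
exact: le_trans qq'.
Qed.

(** [tail_gf] is Lipschitz on [0, c] with constant W(c)/(1 - c): W is nondecreasing, while (1 - q)
    W(q) is nonincreasing, which bounds the growth of W from above. *)
Lemma tail_gf_continuous c : 0 <= c < 1 -> {within `[0, c], continuous tail_gf}.
Proof.
move=> /andP[c0 c1].
pose L := tail_gf c / (1 - c).
have Wc0 : 0 <= tail_gf c by rewrite (le_trans (N_ge0 0%N))// tail_gf_ge_N0 ?c0.
have L0 : 0 <= L by rewrite divr_ge0// subr_ge0 ltW.
have lip x y : 0 <= x -> x <= y -> y <= c ->
    `|tail_gf y - tail_gf x| <= L * `|y - x|.
  move=> x0 xy yc.
  have y1 := le_lt_trans yc c1.
  have Wxy := ler_tail_gf x y x0 xy y1.
  rewrite !ger0_norm ?subr_ge0//.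
  have A := ger_onem_tail_gf x y x0 xy y1.
  have Wyc := ler_tail_gf y c (le_trans x0 xy) yc c1.
  have B : (1 - y) * (tail_gf y - tail_gf x) <= (y - x) * tail_gf c.
    (* Subtract (1 - y) W(x) from both sides of [A]. *)
    apply: (@le_trans _ _ ((y - x) * tail_gf x)); first by nra.
    by rewrite ler_wpM2l ?subr_ge0// (le_trans Wxy).
  rewrite /L mulrAC ler_pdivlMr ?subr_gt0// [leRHS]mulrC.
  apply: le_trans B; rewrite mulrC ler_wpM2r ?subr_ge0//.
  by rewrite lerD2l lerN2.
apply/subspace_continuousP => x /=; rewrite in_itv/= => /andP[x0 xc].
apply/cvgrPdist_le => e e0; rewrite near_withinE.
(* [L] may be 0, hence the division by [L + 1]. *)
have d0 : 0 < e / (L + 1) by rewrite divr_gt0// ltr_wpDl.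
near=> y => /=; rewrite in_itv/= => /andP[y0 yc].
have xy : `|x - y| <= e / (L + 1).
  by near: y; apply: cvgr_dist_le.
apply: (@le_trans _ _ (L * `|x - y|)).
  have [yx|/ltW xy'] := leP y x; first exact: lip.
  by rewrite distrC (distrC x); exact: lip.
apply: (@le_trans _ _ (L * (e / (L + 1)))); first by rewrite ler_wpM2l.
rewrite mulrCA ger_pMr// ler_pdivrMr ?ltr_wpDl// mul1r lerDl//.
Unshelve. all: by end_near. Qed.

(** A product of a positive increasing factor and a nondecreasing one; strictness comes from W >=
    [N 0] > 0. *)
Lemma tail_equation_uniq (r a q q' : R) : 0 < N 0%N -> 0 < r ->
  r < q < 1 -> r < q' < 1 ->
  (q - r) * tail_gf q = a -> (q' - r) * tail_gf q' = a -> q = q'.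
Proof.
move=> N0 r0.
suff H x y : r < x -> x < y -> y < 1 ->
    (x - r) * tail_gf x < (y - r) * tail_gf y.
  move=> /andP[rq q1] /andP[rq' q'1] E E'.
  have [lt|lt|//] := ltgtP q q'.
  - by have := H _ _ rq lt q'1; rewrite E E' ltxx.
  - by have := H _ _ rq' lt q1; rewrite E E' ltxx.
move=> rx xy y1; have x0 : 0 <= x by rewrite ltW// (lt_trans r0).
have ry := lt_trans rx xy.
apply: (@le_lt_trans _ _ ((x - r) * tail_gf y)).
  by rewrite ler_wpM2l ?subr_ge0 ?(ltW rx)// ler_tail_gf// ltW.
rewrite ltr_pM2r ?ltrD2r// (lt_le_trans N0)// tail_gf_ge_N0// y1 andbT ltW//.
exact: lt_trans ry.
Qed.

(** Intermediate values on [r, c]: the function vanishes at r and exceeds [a] at a suitable c < 1.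
    Asking for a finite [K] also covers a divergent sum of [N], that is, mean minus infinity. *)
Lemma tail_equation_ex (r a : R) (K : nat) : 0 < r < 1 -> 0 < a ->
  a < (1 - r) * \sum_(0 <= k < K) N k ->
  exists2 q, r < q < 1 & (q - r) * tail_gf q = a.
Proof.
move=> /andP[r0 r1] a0 aK.
have [c /andP[rc c1] ac] : exists2 c, r < c < 1 & a < (c - r) * tail_gf c.
  (* The truncation at [K] is a polynomial, so it is continuous at 1, where W itself may diverge;
     below 1 it bounds the full function from below. *)
  pose g (x : R) := (x - r) * series (tail_term x) K.
  have gc : {for 1, continuous g}.
    rewrite /g; apply: cvgM; first by apply: cvgB; [exact: cvg_id|exact: cvg_cst].
    rewrite /series/=; apply: cvg_big => [|k _]; first exact: add_continuous.
    by apply: cvgMr; exact: exprn_continuous.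
  have g1 : g 1 = (1 - r) * \sum_(0 <= k < K) N k.
    rewrite /g /series/=; congr (_ * _); apply: eq_bigr => k _.
    by rewrite /tail_term expr1n mulr1.
  have : \forall x \near 1^'-, [/\ r < x, x < 1 & a < g x].
    near=> x; split.
    - by near: x; apply: nbhs_left_gt.
    - by near: x; apply: nbhs_left_lt.
    - near: x; apply: (cvgr_gt (g 1)); last by rewrite g1.
      by apply: cvg_at_left_filter.
  case/filter_ex => x [rx x1 ax]; exists x; first by rewrite rx.
  rewrite (lt_le_trans ax)// ler_wpM2l ?subr_ge0 ?(ltW rx)//.
  by apply: tail_gf_ge_series; rewrite x1 andbT ltW// (lt_trans r0).
have c0 : 0 < c := lt_trans r0 rc.
have cont : {within `[r, c], continuous (fun x => (x - r) * tail_gf x)}.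
  have cW : {within `[r, c], continuous tail_gf}.
    apply: (@continuous_subspaceW _ _ _ `[0, c]).
      by apply: subset_itvr; rewrite bnd_simp ltW.
    by apply: tail_gf_continuous; rewrite c1 ltW.
  have cB : {within `[r, c], continuous (fun x => x - r)}.
    apply: continuous_subspaceT => y.
    by apply: cvgB; [exact: cvg_id|exact: cvg_cst].
  by move=> x; apply: cvgM; [exact: cB|exact: cW].
have [] := @IVT R _ r c a (ltW rc) cont.
  rewrite subrr mul0r ge_min le_max (ltW a0) (ltW ac) orbT //.
move=> q; rewrite in_itv/= => /andP[rq qc] E.
exists q => //; rewrite (le_lt_trans qc c1) andbT lt_neqAle rq andbT.
by apply/negP => /eqP rqE; move: E a0; rewrite -rqE subrr mul0r => ->; rewrite ltxx.
Unshelve. all: by end_near. Qed.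

End tail_series.

(** * The moment equation *)

Lemma eseries_EFin (R : realType) (u : R^nat) (l : R) :
  series u @ \oo --> l -> (\sum_(0 <= k <oo) (u k)%:E)%E = l%:E.
Proof.
move=> ul; rewrite (_ : (fun n => _) = EFin \o series u); last first.
  by apply/funext => n; rewrite /= /series/= sumEFin.
by rewrite EFin_lim ?(cvgP _ ul)// (cvg_lim (@Rhausdorff R) ul).
Qed.

Section geometric_right_tail.
Variables (R : realType) (f : int -> \bar R) (N : R^nat) (xi r : R).
Hypothesis xi01 : 0 < xi < 1.
Hypothesis r01 : 0 < r < 1.
Hypothesis N_ge0 : forall k, 0 <= N k.
Hypothesis N_le1 : forall k, N k <= 1.
Hypothesis N_noninc : forall k, N k.+1 <= N k.
Hypothesis N0E : N 0%N = 1 - xi.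
Hypothesis f_pos : forall k : nat, f k%:Z = (xi * r ^+ k * (1 - r))%:E.
Hypothesis f_neg : forall k : nat, f (- k.+1%:Z) = (N k - N k.+1)%:E.

(** The nonnegative half is geometric of ratio r/q < 1, and the negative half is given by
    [tail_gf_abel]. The factor 1 - q exhibits the trivial root s = 1, which is divided out
    afterwards. *)
Lemma zsum_pgfE q : r < q < 1 ->
  zsum (fun x => ((q^-1) ^ x)%:E * f x)%E =
  (1 + (1 - q) * (xi * r / (q - r) - tail_gf R N q))%:E.
Proof.
move=> /andP[rq q1]; have /andP[r0 r1] := r01.
have q0 : 0 < q := lt_trans r0 rq.
have qr : q - r != 0 by rewrite subr_eq0 gt_eqF.
rewrite /zsum.
have -> : (\sum_(0 <= k <oo) ((q^-1 ^ k%:Z)%:E * f k%:Z))%E =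
    (xi * (1 - r) * (1 - r / q)^-1)%:E.
  under eq_eseriesr => k _.
    rewrite f_pos -EFinM.
    rewrite (_ : _ * _ = geometric (xi * (1 - r)) (r / q) k); last first.
      by rewrite /= -exprnP expr_div_n exprVn; ring.
    over.
  apply: eseries_EFin; apply: cvg_geometric_series.
  by rewrite ger0_norm ?divr_ge0 ?ltW// ltr_pdivrMr// mul1r.
have -> : (\sum_(0 <= k <oo) ((q^-1 ^ (- k.+1%:Z))%:E * f (- k.+1%:Z)))%E =
    (N 0%N - (1 - q) * tail_gf R N q)%:E.
  under eq_eseriesr => k _.
    rewrite f_neg -EFinM exprz_inv opprK -exprnP.
    over.
  apply: eseries_EFin; apply: tail_gf_abel => //.
  by rewrite q1 andbT ltW.
rewrite -EFinD N0E; congr EFin; field.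
by rewrite qr gt_eqF.
Qed.

Lemma zsum_pgf_eq1 q : r < q < 1 ->
  zsum (fun x => ((q^-1) ^ x)%:E * f x)%E = 1%E <->
  (q - r) * tail_gf R N q = xi * r.
Proof.
move=> rq1; rewrite zsum_pgfE//; have /andP[rq q1] := rq1.
have qr : q - r != 0 by rewrite subr_eq0 gt_eqF.
have q10 : 1 - q != 0 by rewrite subr_eq0 gt_eqF.
split=> [[]|E].
  rewrite -[RHS]addr0 => /addrI/eqP; rewrite mulf_eq0 (negbTE q10)/=.
  by rewrite subr_eq0 => /eqP <-; field.
by rewrite -E mulrAC divff// mul1r subrr mulr0 addr0.
Qed.

(** Split at j = x. The terms j <= x sum to xi (q^(x+1) - r^(x+1)), whose second part cancels the
    inhomogeneous term; the terms j > x form the Abel series, and the equation for q closes the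
    identity. *)
Lemma geometric_solution q (x : nat) : r < q < 1 ->
  (q - r) * tail_gf R N q = xi * r ->
  ((xi * r ^+ x.+1)%:E +
    \sum_(0 <= j <oo) f (x%:Z - j%:Z) * ((q - r) / (1 - r) * q ^+ j)%:E)%E =
  ((q - r) / (1 - r) * q ^+ x)%:E.
Proof.
move=> /andP[rq q1] E; have /andP[r0 r1] := r01.
have q0 : 0 < q := lt_trans r0 rq.
have qr : q - r != 0 by rewrite subr_eq0 gt_eqF.
have r10 : 1 - r != 0 by rewrite subr_eq0 gt_eqF.
set C := (q - r) / (1 - r).
have C0 : 0 <= C by rewrite divr_ge0// subr_ge0 ltW.
(* The index j = i + x + 1 corresponds to a jump of -(i + 1). *)
have fE (i : nat) : f (x%:Z - (i + x.+1)%N%:Z) = (N i - N i.+1)%:E.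
  by rewrite -f_neg; congr f; lia.
have fge0 j : (0 <= f (x%:Z - j%:Z) * (C * q ^+ j)%:E)%E.
  rewrite mule_ge0//; last by rewrite lee_fin mulr_ge0// exprn_ge0// ltW.
  have [jx|xj] := leqP j x.
    rewrite subzn// f_pos lee_fin !mulr_ge0 ?exprn_ge0 ?subr_ge0// ltW//.
    by case/andP: xi01.
  by rewrite -(subnK xj) fE lee_fin subr_ge0.
rewrite (nneseries_split 0 x.+1)// add0n -nneseries_addn//.
under [X in (_ + (_ + X))%E]eq_eseriesr => i _.
  rewrite fE -EFinM.
  rewrite (_ : (N i - N i.+1) * _ = C * q ^+ x * (q ^+ i.+1 * (N i - N i.+1))); last first.
    by rewrite exprD !exprS; ring.
  over.
have -> : (\sum_(0 <= i <oo) (C * q ^+ x * (q ^+ i.+1 * (N i - N i.+1)))%:E)%E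
    = (C * q ^+ x * (N 0%N - (1 - q) * tail_gf R N q))%:E.
  apply: eseries_EFin.
  rewrite (_ : series _ = fun n => C * q ^+ x *
      series (fun i => q ^+ i.+1 * (N i - N i.+1)) n); last first.
    by apply/funext => n; rewrite /series/= mulr_sumr.
  by apply: cvgMr; apply: tail_gf_abel => //; rewrite q1 andbT ltW.
have -> : (\sum_(0 <= j < x.+1) f (x%:Z - j%:Z) * (C * q ^+ j)%:E)%E =
    (xi * (q ^+ x.+1 - r ^+ x.+1))%:E.
  (* The normalisation of [C] gives C (1 - r) = q - r, exactly the factor in the factorisation of
     q^(x+1) - r^(x+1). *)
  rewrite -opprB subrXX mulrN mulrA big_mkord -mulNr mulr_sumr -sumEFin.
  apply: eq_bigr => j _.
  rewrite subzn -1?ltnS// f_pos -EFinM /C /=; congr EFin; field.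
  by rewrite r10.
rewrite -!EFinD N0E; congr EFin.
have -> : tail_gf R N q = xi * r / (q - r) by rewrite -E; field.
rewrite /C !exprS; field.
by rewrite qr r10.
Qed.

End geometric_right_tail.

(** * Substochastic renewal equations *)

Section substochastic_iteration.
Local Open Scope ereal_scope.
Variables (R : realType) (a : nat -> nat -> \bar R) (b : nat -> \bar R).
Hypothesis a_ge0 : forall x j, 0 <= a x j.
Hypothesis b_ge0 : forall x, 0 <= b x.
Hypothesis a_b_le1 : forall x, b x + \sum_(0 <= j <oo) a x j <= 1.

(** With [a x j] the chance of moving from x to j and [b x] that of succeeding at once, this is the
    chance of success within n steps. *)
Fixpoint substoch_iter (n : nat) (x : nat) : \bar R :=
  if n is n'.+1 then b x + \sum_(0 <= j <oo) a x j * substoch_iter n' j else 0.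

Lemma substoch_iter_ge0 n x : 0 <= substoch_iter n x.
Proof.
elim: n x => [//|n IH] x /=.
by rewrite adde_ge0// nneseries_ge0// => j _ _; rewrite mule_ge0.
Qed.

Lemma substoch_iter_leS n x : substoch_iter n x <= substoch_iter n.+1 x.
Proof.
elim: n x => [|n IH] x; first exact: substoch_iter_ge0.
rewrite [leLHS]/= [leRHS]/=; apply: leeD2l; apply: lee_nneseries => j _.
  by rewrite mule_ge0// substoch_iter_ge0.
exact: lee_wpmul2l.
Qed.

Lemma is_cvg_substoch_iter x : cvgn (substoch_iter ^~ x).
Proof.
apply: ereal_nondecreasing_is_cvgn; apply/nondecreasing_seqP => n.
exact: substoch_iter_leS.
Qed.

Lemma substoch_iter_le_fixpoint (h : nat -> \bar R) :
  (forall x, 0 <= h x) ->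
  (forall x, b x + \sum_(0 <= j <oo) a x j * h j = h x) ->
  forall n x, substoch_iter n x <= h x.
Proof.
move=> h0 hE; elim=> [//|n IH] x /=.
rewrite -[leRHS]hE leeD2l//; apply: lee_nneseries => j _.
  by rewrite mule_ge0// substoch_iter_ge0.
exact: lee_wpmul2l.
Qed.

(** Each finite truncation of the sum passes to the limit in n and is dominated by the next iterate.
    This inequality is all that the comparison with a solution requires. *)
Lemma substoch_iter_lim_supersolution x :
  b x + \sum_(0 <= j <oo) a x j * limn (substoch_iter ^~ j) <=
  limn (substoch_iter ^~ x).
Proof.
have U0 j : 0 <= limn (substoch_iter ^~ j).
  apply: lime_ge; first exact: is_cvg_substoch_iter.
  by apply: nearW => n; exact: substoch_iter_ge0.
have le_lim n y : substoch_iter n y <= limn (substoch_iter ^~ y).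
  have nd : nondecreasing_seq (substoch_iter ^~ y).
    by apply/nondecreasing_seqP => k; exact: substoch_iter_leS.
  rewrite (cvg_lim _ (ereal_nondecreasing_cvgn nd))//.
  by apply: ereal_sup_ubound; exists n.
have b1 : b x \is a fin_num.
  rewrite ge0_fin_numE// (@le_lt_trans _ _ 1) ?ltry//.
  by rewrite (le_trans _ (a_b_le1 x))// leeDl// nneseries_ge0.
(* Since [b x] is finite it can be moved to the right, leaving a bare limit in [J] to bound. *)
rewrite addeC -leeBrDr//.
apply: lime_le.
  by apply: is_cvg_nneseries => j _ _; rewrite mule_ge0.
apply: nearW => J.
have afin j : a x j \is a fin_num.
  rewrite ge0_fin_numE// (@le_lt_trans _ _ 1) ?ltry//.
  apply: (le_trans _ (a_b_le1 x)); rewrite (le_trans _ (leeDr _ (b_ge0 x)))//.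
  rewrite (le_trans _ (nneseries_lim_ge j.+1 _))//.
  by rewrite big_nat_recr//= leeDr// sume_ge0.
have c : (\sum_(0 <= j < J) a x j * substoch_iter n j) @[n --> \oo] -->
    \sum_(0 <= j < J) a x j * limn (substoch_iter ^~ j).
  apply: cvg_nnesum => j _; first by apply: nearW => n; rewrite mule_ge0// substoch_iter_ge0.
  by apply: cvgeZl => //; exact: is_cvg_substoch_iter.
rewrite -(cvg_lim _ c)//; apply: lime_le; first exact: cvgP c.
apply: nearW => n; rewrite leeBrDr// addeC.
apply: le_trans (le_lim n.+1 x); rewrite /= leeD2l//.
by apply: nneseries_lim_ge => j _ _; rewrite mule_ge0// substoch_iter_ge0.
Qed.

(* Maximum principle: where [h - v] is maximal, the loss of mass [b x > 0]
   contradicts [h - v] being positive. *)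
Lemma substoch_solution_le_supersolution (h v : R^nat) :
  (forall x, 0 < b x) ->
  (forall x, (0 <= v x)%R) ->
  (forall x, b x + \sum_(0 <= j <oo) a x j * (h j)%:E = (h x)%:E) ->
  (forall x, b x + \sum_(0 <= j <oo) a x j * (v j)%:E <= (v x)%:E) ->
  (forall x, (0 <= h x)%R) ->
  h @ \oo --> (0 : R)%R -> forall x, (h x <= v x)%R.
Proof.
move=> b_gt0 v0 hE vE h0 hcvg x0; rewrite leNgt; apply/negP => lt0.
pose e := (h x0 - v x0)%R.
have e0 : (0 < e)%R by rewrite subr_gt0.
(* As [v] >= 0, the difference stays below [e] from [M] on, so its maximum is attained among the
   finitely many indices below [M]. *)
have [M _ hM] : \forall j \near \oo, (h j < e)%R by exact: cvgr_lt hcvg _ _.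
have x0M : (x0 < M)%N.
  rewrite ltnNge; apply/negP => /hM /=; rewrite /e ltrBDl => /(le_lt_trans _).
  by move=> /(_ (h x0)); rewrite lerDr v0 ltxx => /(_ isT).
pose i0 := Ordinal x0M.
case: (@arg_maxP _ _ _ i0 xpredT (fun i : 'I_M => (h i - v i)%R) isT) => x _ xmax.
pose m := (h x - v x)%R.
have em : (e <= m)%R := xmax i0 isT.
have m0 : (0 < m)%R := lt_le_trans e0 em.
have hv j : (h j <= v j + m)%R.
  have [jM|Mj] := ltnP j M.
    by rewrite -lerBlDl; exact: (xmax (Ordinal jM) isT).
  by rewrite (le_trans (ltW (hM _ Mj)))// (le_trans em)// lerDr.
have Sa0 : 0 <= \sum_(0 <= j <oo) a x j by rewrite nneseries_ge0.
have := hE x.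
suff : b x + \sum_(0 <= j <oo) a x j * (h j)%:E < (h x)%:E.
  by move=> /[swap] ->; rewrite ltxx.
have -> : h x = (v x + m)%R by rewrite /m addrC subrK.
have S1 : \sum_(0 <= j <oo) a x j < 1.
  apply: lt_le_trans (a_b_le1 x).
  have Sfin : \sum_(0 <= j <oo) a x j \is a fin_num.
    rewrite ge0_fin_numE// (@le_lt_trans _ _ 1) ?ltry//.
    by rewrite (le_trans _ (a_b_le1 x))// leeDr.
  by rewrite lteDr.
apply: (@le_lt_trans _ _ (b x + (\sum_(0 <= j <oo) a x j * (v j)%:E +
    m%:E * \sum_(0 <= j <oo) a x j))).
  rewrite leeD2l// -nneseriesZl// -nneseriesD//; last 2 first.
    by move=> j _ _; rewrite mule_ge0// lee_fin.
    by move=> j _ _; rewrite mule_ge0// lee_fin ltW.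
  apply: lee_nneseries => j _; first by rewrite mule_ge0// lee_fin.
  rewrite [m%:E * _]muleC -ge0_muleDr ?lee_fin ?(ltW m0)//.
  by rewrite lee_wpmul2l// -EFinD lee_fin.
rewrite addeA [ltRHS]EFinD lee_ltD//.
  rewrite ge0_fin_numE ?(le_lt_trans (vE x)) ?ltry//.
  by rewrite adde_ge0// nneseries_ge0// => j _ _; rewrite mule_ge0// lee_fin.
by rewrite -[ltRHS]mule1 lte_pmul2l// lte_fin.
Qed.

Lemma cvg_substoch_iter (h : R^nat) :
  (forall x, 0 < b x) ->
  (forall x, (0 <= h x)%R) ->
  (forall x, b x + \sum_(0 <= j <oo) a x j * (h j)%:E = (h x)%:E) ->
  h @ \oo --> (0 : R)%R ->
  forall x, substoch_iter ^~ x @ \oo --> (h x)%:E.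
Proof.
move=> b_gt0 h0 hE hcvg x.
have Uh y : limn (substoch_iter ^~ y) <= (h y)%:E.
  apply: lime_le; first exact: is_cvg_substoch_iter.
  apply: nearW => n.
  exact: (@substoch_iter_le_fixpoint (fun y => (h y)%:E)).
have U0 j : 0 <= limn (substoch_iter ^~ j).
  apply: lime_ge; first exact: is_cvg_substoch_iter.
  by apply: nearW => n; exact: substoch_iter_ge0.
(* The bound by [h] makes the limit finite, so [fine] loses nothing. *)
pose v y := fine (limn (substoch_iter ^~ y)).
have vE y : (v y)%:E = limn (substoch_iter ^~ y).
  by rewrite fineK// ge0_fin_numE// (le_lt_trans (Uh y))// ltry.
have hv : (h x <= v x)%R.
  apply: substoch_solution_le_supersolution => // y; first exact: fine_ge0.
  rewrite vE; under eq_eseriesr do rewrite vE.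
  exact: substoch_iter_lim_supersolution.
suff <- : limn (substoch_iter ^~ x) = (h x)%:E by exact: is_cvg_substoch_iter.
by apply/eqP; rewrite eq_le Uh -vE lee_fin.
Qed.

End substochastic_iteration.

(** * First-step decomposition of the walk *)

Section first_passage.
Variables (d : measure_display) (T : measurableType d) (R : realType).
Variables (P : probability T R) (X : nat -> {RV P >-> R}).
Hypothesis X_int : forall n t, X n t \is a Num.int.

Definition step_pmf (x : int) : \bar R := P [set t | X 0%N t = x%:~R].
Definition step_ccdf (x : nat) : \bar R := P [set t | x%:R < X 0%N t].

(** The first [m] steps are discarded. Peeling off one step raises [m] by one, so the induction on
    [n] must range over all [m]. *)
Definition passage (m n x : nat) : set T :=
  [set t | exists2 j, (j <= n)%N & x%:R < walk (fun i => X (m + i)%N) j t].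

(** Indexing by [iota 0 m] matches the duplicate-free sequences of [mutually_independent]. *)
Definition cylinder (m : nat) (B : nat -> set R) : set T :=
  \bigcap_(i in [set` iota 0 m]) X i @^-1` B i.

Lemma measurable_walk (m j : nat) :
  measurable_fun setT (walk (fun i => X (m + i)%N) j).
Proof. by apply: measurable_sum => i. Qed.

Lemma measurable_walk_gt (m j x : nat) :
  measurable [set t | x%:R < walk (fun i => X (m + i)%N) j t].
Proof.
rewrite (_ : [set t | _] = setT `&` walk (fun i => X (m + i)%N) j @^-1` `]x%:R, +oo[).
  by apply: measurable_walk.
by rewrite setTI; apply/seteqP; split=> t /=; rewrite in_itv/= andbT.
Qed.

Lemma measurable_passage m n x : measurable (passage m n x).
Proof.
rewrite (_ : passage m n x = \bigcup_(j in [set j | (j <= n)%N])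
    [set t | x%:R < walk (fun i => X (m + i)%N) j t]).
  by apply: bigcup_measurable => j _; exact: measurable_walk_gt.
by apply/seteqP; split=> t [j jn ?]; exists j.
Qed.

Lemma measurable_cylinder m B : (forall i, measurable (B i)) ->
  measurable (cylinder m B).
Proof.
by move=> mB; apply: bigcap_measurableType => i _; exact: measurable_funPTI.
Qed.

Lemma cylinderS m (B : nat -> set R) (C : set R) :
  cylinder m.+1 (fun i => if i == m then C else B i) =
  cylinder m B `&` X m @^-1` C.
Proof.
have in_iota k i : [set` iota 0 k] i = (i < k)%N by rewrite /mkset mem_iota.
apply/seteqP; split=> [t H|t [H Hm] i].
  split; last by have := H m; rewrite in_iota ltnSn /= eqxx; apply.
  move=> i; rewrite in_iota => im.
  by have := H i; rewrite in_iota ltnS (ltnW im) /= (ltn_eqF im); apply.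
rewrite in_iota ltnS leq_eqVlt /=.
have [-> _|ne/= im] := eqVneq i m; first by [].
by apply: H; rewrite in_iota.
Qed.

Definition step_gt (m x : nat) : set T := X m @^-1` `]x%:R, +oo[.
(** From threshold [x], a step of size x - j leaves the threshold [j] still to be exceeded. *)
Definition step_below (m x j : nat) : set T := X m @^-1` [set (x%:Z - j%:Z)%:~R].

Lemma measurable_step_gt m x : measurable (step_gt m x).
Proof. exact: measurable_funPTI. Qed.

Lemma measurable_step_below m x j : measurable (step_below m x j).
Proof. exact: measurable_funPTI. Qed.

(** Countable additivity: the step exceeds x in the first event and equals x - j in the others, so
    all of them are disjoint. *)
Lemma first_step_decomposition m x (E : set T) (F : nat -> set T) :
  measurable E -> (forall j, measurable (F j)) ->
  P (E `&` (step_gt m x `|` \bigcup_j (step_below m x j `&` F j))) =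
  (P (E `&` step_gt m x) +
   \sum_(0 <= j <oo) P (E `&` step_below m x j `&` F j))%E.
Proof.
move=> mE mF.
have mG j : measurable (step_below m x j `&` F j).
  by apply: measurableI => //; exact: measurable_step_below.
rewrite setIUr setI_bigcupr measureU; last 3 first.
- by apply: measurableI => //; exact: measurable_step_gt.
- by apply: bigcup_measurable => j _; exact: measurableI.
- apply/seteqP; split=> // t [[_]].
  rewrite /step_gt /= in_itv/= andbT => lt [j _ [_ [/= eq _]]].
  by move: lt; rewrite eq pmulrn ltr_int; lia.
congr (_ + _)%E; apply: etrans.
  apply: (@measure_semi_bigcup _ _ _ P
      (fun j => E `&` (step_below m x j `&` F j))).
  - by move=> j; exact: measurableI.
  - move=> i j _ _ [t [[_ [e1 _]] [_ [e2 _]]]].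
    by have /intr_inj := etrans (esym e1) e2; lia.
  - by apply: bigcup_measurable => j _; exact: measurableI.
by apply: eq_eseriesr => j _; rewrite setIA.
Qed.

(** An integer step either exceeds x or equals x - j for some j >= 0; in the latter case the
    remaining walk must exceed j. The empty walk is 0 and never exceeds a natural threshold. *)
Lemma passageS m n x :
  passage m n.+1 x =
  step_gt m x `|` \bigcup_j (step_below m x j `&` passage m.+1 n j).
Proof.
have walkS j t : walk (fun i => X (m + i)%N) j.+1 t =
    X m t + walk (fun i => X (m.+1 + i)%N) j t.
  rewrite /walk big_ord_recl addn0; congr (_ + _); apply: eq_bigr => i _.
  by rewrite /= /bump/= add1n addnS addSn.
apply/seteqP; split=> t.
- move=> [[|j] jn]; first by rewrite /walk big_ord0 ltNge ler0n.
  rewrite walkS => lt.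
  have [Xx|Xx] := ltP (x%:R) (X m t).
    by left; rewrite /step_gt/= in_itv/= Xx.
  right; have /intrP[z zE] := X_int m t.
  have zx : (z <= x%:Z)%R by rewrite -(ler_int R) -zE.
  exists `|x%:Z - z|%N => //; split.
    by rewrite /step_below/= zE; congr (_%:~R); lia.
  exists j => //.
  rewrite pmulrn.
  rewrite (_ : `|x%:Z - z|%N%:Z = x%:Z - z); last by lia.
  by rewrite intrD intrN -zE ltrBlDl.
- move=> [|[j _ [eq [i in_ lt]]]].
    rewrite /step_gt/= in_itv/= andbT => lt; exists 1%N => //.
    by rewrite walkS /walk big_ord0 addr0.
  have XE : X m t = (x%:Z - j%:Z)%:~R := eq.
  exists i.+1 => //; rewrite walkS XE.
  by rewrite intrD intrN -!pmulrn -addrA ltrDl addrC subr_gt0.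
Qed.

Hypothesis X_indep : mutually_independent P (fun n => X n).
Hypothesis X_id : identically_distributed P (fun n => X n).

Lemma cylinder_indep m B C : (forall i, measurable (B i)) -> measurable C ->
  P (cylinder m B `&` X m @^-1` C) = (P (cylinder m B) * P (X 0%N @^-1` C))%E.
Proof.
move=> mB mC; rewrite -cylinderS.
have mBC i : measurable (if i == m then C else B i) by case: ifP.
rewrite !X_indep ?iota_uniq// -(addn1 m) iotaD big_cat big_seq1 /= add0n eqxx.
rewrite X_id//; congr (_ * _)%E; apply: eq_big_seq => i.
by rewrite mem_iota/= add0n => /ltn_eqF ->.
Qed.

Lemma step_gtE x : P (X 0%N @^-1` `]x%:R, +oo[) = step_ccdf x.
Proof.
by congr (P _); apply/seteqP; split=> t; rewrite /= in_itv/= andbT.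
Qed.

(* The cylinder over the steps already taken carries the induction on [n]. *)
Lemma passage_indep n m B x : (forall i, measurable (B i)) ->
  P (cylinder m B `&` passage m n x) =
  (P (cylinder m B) *
   substoch_iter R (fun x j => step_pmf (x%:Z - j%:Z)) step_ccdf n x)%E.
Proof.
elim: n m B x => [|n IH] m B x mB.
  rewrite mule0 (_ : _ `&` _ = set0) ?measure0//.
  apply/seteqP; split=> // t [_ [j]]; rewrite leqn0 => /eqP ->.
  by rewrite /walk big_ord0 ltNge ler0n.
rewrite passageS first_step_decomposition; last 2 first.
- exact: measurable_cylinder.
- by move=> j; exact: measurable_passage.
rewrite cylinder_indep// step_gtE.
have iter0 := @substoch_iter_ge0 R (fun x j => step_pmf (x%:Z - j%:Z))
  step_ccdf (fun _ _ => measure_ge0 _ _) (fun _ => measure_ge0 _ _).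
have fin : P (cylinder m B) \is a fin_num.
  exact: fin_num_measure (measurable_cylinder _ _ mB).
rewrite [substoch_iter _ _ _ _ _]/= ge0_muleDr; last 2 first.
- exact: measure_ge0.
- by rewrite nneseries_ge0// => j _ _; rewrite mule_ge0// iter0.
congr (_ + _)%E.
rewrite -[X in (X * \sum_(_ <= _ <oo) _)%E](fineK fin) -nneseriesZl; last first.
  by move=> j _; rewrite mule_ge0// iter0.
apply: eq_eseriesr => j _; rewrite fineK// muleA.
(* The prescribed value of step [m] is absorbed into a longer cylinder, to which the induction
   hypothesis at [m.+1] applies. *)
rewrite /step_below -cylinderS IH; last by move=> i; case: ifP.
by rewrite cylinderS cylinder_indep.
Qed.

Lemma step_total x :
  (step_ccdf x + \sum_(0 <= j <oo) step_pmf (x%:Z - j%:Z))%E = 1%E.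
Proof.
rewrite -(@probability_setT _ _ _ P).
rewrite -[in RHS](setTI setT).
rewrite -{2}(_ : step_gt 0 x `|` \bigcup_j (step_below 0 x j `&` setT) = setT).
  rewrite first_step_decomposition// setTI step_gtE.
  by congr (_ + _)%E; apply: eq_eseriesr => j _; rewrite setTI setIT.
apply/seteqP; split=> // t _.
have [Xx|Xx] := ltP (x%:R) (X 0%N t).
  by left; rewrite /step_gt/= in_itv/= Xx.
right; have /intrP[z zE] := X_int 0%N t.
have zx : (z <= x%:Z)%R by rewrite -(ler_int R) -zE.
exists `|x%:Z - z|%N => //; split=> //.
by rewrite /step_below/= zE; congr (_%:~R); lia.
Qed.

(** The events [passage 0 n x] increase with n to the event of ever exceeding x; the cylinder over
    no steps is the whole space. *)
Lemma cvg_passage x :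
  substoch_iter R (fun x j => step_pmf (x%:Z - j%:Z)) step_ccdf ^~ x @ \oo -->
  P [set t | exists n, x%:R < walk (fun n => X n) n t].
Proof.
have -> : [set t | exists n, x%:R < walk (fun n => X n) n t] =
    \bigcup_n passage 0 n x.
  apply/seteqP; split=> t.
    by move=> [n lt]; exists n => //; exists n.
  by move=> [n _ [j _ lt]]; exists j.
rewrite (_ : _ ^~ x = P \o (passage 0 ^~ x)); last first.
  apply/funext => n /=.
  have := passage_indep n 0%N (fun=> setT) x (fun=> measurableT).
  by rewrite /cylinder /= set_nil bigcap_set0 setTI probability_setT mul1e.
apply: nondecreasing_cvg_mu.
- by move=> n; exact: measurable_passage.
- by apply: bigcup_measurable => n _; exact: measurable_passage.
- move=> n m nm; apply/subsetPset => t [j jn lt]; exists j => //.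
  exact: leq_trans nm.
Qed.

End first_passage.

(** * Integer-valued laws *)

Section integer_valued.
Variables (d : measure_display) (T : measurableType d) (R : realType).
Variable P : probability T R.

Lemma measurable_ge (Y : T -> R) (c : R) :
  measurable_fun setT Y -> measurable [set t | c <= Y t].
Proof.
move=> mY; rewrite (_ : [set t | _] = setT `&` Y @^-1` `[c, +oo[).
  by apply: mY.
by rewrite setTI; apply/seteqP; split=> t /=; rewrite in_itv/= andbT.
Qed.

Lemma probability_int_eq (Y : T -> R) (z : int) :
  measurable_fun setT Y -> (forall t, Y t \is a Num.int) ->
  P [set t | Y t = z%:~R] =
  (P [set t | (z%:~R <= Y t)%R] - P [set t | ((z + 1)%:~R <= Y t)%R])%E.
Proof.
move=> mY Yint.
have sub : [set t | (z + 1)%:~R <= Y t] `<=` [set t | z%:~R <= Y t].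
  by move=> t /=; apply: le_trans; rewrite ler_int; lia.
rewrite -[X in (_ - P X)%E](setIidr sub) -measureD; last 3 first.
- exact: measurable_ge.
- exact: measurable_ge.
- by rewrite ltey_eq fin_num_measure//; exact: measurable_ge.
congr (P _); apply/seteqP; split=> t /=; have /intrP[y ->] := Yint t.
- by move=> /intr_inj ->; split; [exact: lexx|rewrite ler_int; lia].
- by move=> [] /=; rewrite !ler_int => ? ?; congr (_%:~R); lia.
Qed.

(** Layer-cake formula: the positive part is the sum of the indicators of k + 1 <= Y, and a
    nonnegative series may be integrated termwise. *)
Lemma integral_int_posE (Y : T -> R) :
  measurable_fun setT Y -> (forall t, Y t \is a Num.int) ->
  (\int[P]_t (Num.max (Y t) 0)%:E =
   \sum_(0 <= k <oo) P [set t | (k.+1%:R <= Y t)%R])%E.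
Proof.
move=> mY Yint.
have E t : (Num.max (Y t) 0)%:E =
    (\sum_(0 <= k <oo) (\1_[set t | (k.+1%:R <= Y t)%R] t)%:E)%E.
  have [n nE] : exists n : nat, Num.max (Y t) 0 = n%:R.
    have /intrP[z ->] := Yint t.
    have [z0|z0] := leP (z%:~R : R) 0; first by exists 0%N.
    exists `|z|%N; rewrite pmulrn; congr (_%:~R).
    by move: z0; rewrite ltr0z; lia.
  have indE k : \1_[set t | (k.+1%:R <= Y t)%R] t = (k < n)%N%:R :> R.
    rewrite indicE; congr (_ %:R); congr nat_of_bool.
    rewrite -(ltr_nat R) -nE.
    apply/idP/idP; rewrite inE/= => H.
      rewrite lt_max (lt_le_trans _ H)// ltr_nat//.
    have : k%:R < n%:R :> R by rewrite -nE.
    rewrite ltr_nat -(ler_nat R) -nE le_max => /orP[//|].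
    by rewrite leNgt ltr0n.
  under eq_eseriesr do rewrite indE.
  rewrite (nneseries_split 0 n)// add0n [X in (_ + X)%E]eseries0 ?adde0; last first.
    by move=> k nk _; rewrite ltnNge nk.
  rewrite nE (eq_big_nat _ _ (F2 := fun=> 1%E)); last first.
    by move=> k /andP[_ ->].
  by rewrite sumEFin sumr_const_nat subn0.
under eq_integral do rewrite E.
rewrite integral_nneseries//; last first.
  move=> k; apply/measurable_EFinP; apply: measurable_indic.
  exact: measurable_ge.
apply: eq_eseriesr => k _; rewrite integral_indic ?setIT//.
exact: measurable_ge.
Qed.

Lemma expectation_intE (Y : T -> R) :
  measurable_fun setT Y -> (forall t, Y t \is a Num.int) ->
  ('E_P[Y] = \sum_(0 <= k <oo) P [set t | (k.+1%:R <= Y t)%R] -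
             \sum_(0 <= k <oo) P [set t | (Y t <= - k.+1%:R)%R])%E.
Proof.
move=> mY Yint.
rewrite expectation.unlock integralE; congr (_ - _)%E.
  by rewrite -integral_int_posE//; apply: eq_integral => t _; rewrite funeposE EFin_max.
under [RHS]eq_eseriesr => k _.
  rewrite (_ : [set t | _] = [set t | (k.+1%:R <= - Y t)%R]); last first.
    by apply/seteqP; split=> t /=; rewrite lerNr.
  over.
rewrite -(integral_int_posE (fun t => - Y t))//.
- by apply: eq_integral => t _; rewrite funenegE EFin_max.
- exact: measurable_funN.
- by move=> t; rewrite rpredN.
Qed.

End integer_valued.

(** * Point masses and left tail of a law with geometric right tail *)

Section geometric_right_tail_law.
Variables (d : measure_display) (T : measurableType d) (R : realType).
Variables (P : probability T R) (Y : T -> R) (xi r : R).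
Hypothesis mY : measurable_fun setT Y.
Hypothesis Y_int : forall t, Y t \is a Num.int.
Hypothesis tailY : forall x : nat, P [set t | x%:R <= Y t] = (xi * r ^+ x)%:E.

Definition left_tail (k : nat) : R := fine (P [set t | Y t <= - k.+1%:R]).

Lemma measurable_le (c : R) : measurable [set t | Y t <= c].
Proof.
rewrite (_ : [set t | _] = [set t | - c <= (\- Y)%R t]); last first.
  by apply/seteqP; split=> t /=; rewrite lerN2.
by apply: measurable_ge; exact: measurable_funN.
Qed.

Lemma left_tailE k : P [set t | Y t <= - k.+1%:R] = (left_tail k)%:E.
Proof. by rewrite fineK// fin_num_measure//; exact: measurable_le. Qed.

Lemma left_tail_ge0 k : 0 <= left_tail k.
Proof. by rewrite fine_ge0. Qed.

Lemma left_tail_le1 k : left_tail k <= 1.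
Proof. by rewrite -lee_fin -left_tailE probability_le1//; exact: measurable_le. Qed.

Lemma left_tail_noninc k : left_tail k.+1 <= left_tail k.
Proof.
rewrite -lee_fin -!left_tailE le_measure ?inE//; try exact: measurable_le.
by move=> t /= /le_trans; apply; rewrite lerN2 ler_nat.
Qed.

Lemma left_tail0 : left_tail 0%N = 1 - xi.
Proof.
have := tailY 0%N; rewrite expr0 mulr1 => E.
apply: EFin_inj; rewrite -left_tailE EFinB -E -probability_setC; last first.
  exact: measurable_ge.
congr (P _); apply/seteqP; split=> t /=; have /intrP[z ->] := Y_int t.
- move=> H; apply/negP; rewrite -ltNge.
  by rewrite (le_lt_trans H)// ltrN10.
- by move=> /negP; rewrite -ltNge ltrz0 -(mulrN1z 1) ler_int; lia.
Qed.

Lemma ccdf_geometric (x : nat) :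
  P [set t | x%:R < Y t] = (xi * r ^+ x.+1)%:E.
Proof.
rewrite -tailY; congr (P _); apply/seteqP.
by split=> t /=; have /intrP[z ->] := Y_int t; rewrite !pmulrn ltr_int ler_int; lia.
Qed.

Lemma pmf_nonneg (k : nat) :
  P [set t | Y t = (k%:Z)%:~R] = (xi * r ^+ k * (1 - r))%:E.
Proof.
rewrite probability_int_eq// (_ : k%:Z + 1 = k.+1%:Z); last by lia.
by rewrite -!pmulrn !tailY -EFinB exprS; congr EFin; ring.
Qed.

Lemma pmf_neg (k : nat) :
  P [set t | Y t = (- k.+1%:Z)%:~R] = (left_tail k - left_tail k.+1)%:E.
Proof.
rewrite (_ : [set t | _] = [set t | (\- Y) t = (k.+1%:Z)%:~R]); last first.
  apply/seteqP; split=> t /=; first by move=> ->; rewrite intrN opprK.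
  by move=> /(congr1 -%R); rewrite opprK intrN.
rewrite probability_int_eq; last 2 first.
- exact: measurable_funN.
- by move=> t; rewrite rpredN.
rewrite (_ : k.+1%:Z + 1 = k.+2%:Z); last by lia.
rewrite -!pmulrn EFinB -!left_tailE; congr (P _ - P _)%E.
- by apply/seteqP; split=> t /=; rewrite lerNr.
- by apply/seteqP; split=> t /=; rewrite lerNr.
Qed.

(** Otherwise every partial sum of left tails is at most xi r/(1 - r), the mean of the positive
    part, and the expectation is nonnegative. *)
Lemma negative_mean_left_tail : 0 < r < 1 -> ('E_P[Y] < 0)%E ->
  exists K, xi * r < (1 - r) * \sum_(0 <= k < K) left_tail k.
Proof.
move=> /andP[r0 r1].
rewrite expectation_intE// => EY; apply: contrapT => /forallNP noK.
move: EY; apply/negP; rewrite -leNgt.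
under eq_eseriesr do rewrite tailY.
rewrite (eseries_EFin _ _ (xi * r / (1 - r))); last first.
  rewrite (_ : (fun k => _) = geometric (xi * r) r); last first.
    by apply/funext => k; rewrite /= exprS mulrA.
  by apply: cvg_geometric_series; rewrite ger0_norm// ltW.
rewrite sube_ge0 ?fin_numE ?orbT//.
apply: lime_le; first by apply: is_cvg_nneseries.
apply: nearW => K; under eq_bigr do rewrite left_tailE.
rewrite sumEFin lee_fin ler_pdivlMr ?subr_gt0// mulrC leNgt.
by apply/negP; exact: noK.
Qed.

End geometric_right_tail_law.

(** * Law of the supremum and identification of the root *)

Theorem mainTheorem2 (d : measure_display) (T : measurableType d) (R : realType)
  (P : probability T R) (X : nat -> {RV P >-> R}) (xi r : R) :
  (forall n t, X n t \is a Num.int) ->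
  mutually_independent P (fun n => X n) ->
  identically_distributed P (fun n => X n) ->
  (* F not concentrated on a half-axis *)
  (0 < P [set t | (X 0%N t < 0)%R])%E -> (0 < P [set t | (0 < X 0%N t)%R])%E ->
  ('E_P[X 0%N] < 0)%E ->
  0 < xi < 1 -> 0 < r < 1 ->
  (forall x : nat, P [set t | x%:R <= X 0%N t] = (xi * r ^+ x)%:E) ->
  let p := fine (P [set t | exists n, 0 < walk (fun n => X n) n t]) in
  let s0 := (1 - (1 - p) * (1 - r))^-1 in
  p < 1 /\
  (forall x : nat,
     P [set t | exists n, x%:R < walk (fun n => X n) n t] =
     (p * (1 - (1 - p) * (1 - r)) ^+ x)%:E) /\
  (1 < s0 < r^-1 /\
   zsum (fun x : int => (s0 ^ x)%:E * P [set t | X 0%N t = (x%:~R)%R])%E = 1%E /\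
   (forall s, 1 < s < r^-1 ->
      zsum (fun x : int => (s ^ x)%:E * P [set t | X 0%N t = (x%:~R)%R])%E = 1%E ->
      s = s0)).
Proof.
move=> X_int indep idd _ _ EX xi01 r01 tailX p s0.
have /andP[r0 r1] := r01; have /andP[xi0 xi1] := xi01.
have mX : measurable_fun setT (X 0%N) by [].
pose N := left_tail _ _ _ P (X 0%N).
have N0 : N 0%N = 1 - xi by apply: left_tail0 tailX => //; exact: X_int.
have N_ge0 k : 0 <= N k by exact: left_tail_ge0.
have N_le1 k : N k <= 1 by exact: left_tail_le1.
have N_noninc k : N k.+1 <= N k by exact: left_tail_noninc.
pose f := step_pmf _ _ _ P X.
have f_pos (k : nat) : f k%:Z = (xi * r ^+ k * (1 - r))%:E.
  by apply: pmf_nonneg => //; exact: X_int.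
have f_neg (k : nat) : f (- k.+1%:Z) = (N k - N k.+1)%:E.
  by apply: pmf_neg => //; exact: X_int.
have [K aK] := negative_mean_left_tail _ _ _ P (X 0%N) xi r mX (X_int 0%N) tailX r01 EX.
have [q rq1 qE] := tail_equation_ex _ N N_ge0 N_le1 N_noninc r _ K r01
  (mulr_gt0 xi0 r0) aK.
have /andP[rq q1] := rq1.
have q0 : 0 < q := lt_trans r0 rq.
have r10 : 1 - r != 0 by rewrite subr_eq0 gt_eqF.
pose h (x : nat) := (q - r) / (1 - r) * q ^+ x.
have Ph (x : nat) : P [set t | exists n, x%:R < walk (fun n => X n) n t] =
    (h x)%:E.
  have b_E y : step_ccdf _ _ _ P X y = (xi * r ^+ y.+1)%:E.
    by apply: ccdf_geometric => //; exact: X_int.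
  have c := cvg_passage _ _ _ P X X_int indep idd x.
  (* The same iterates tend to the passage probability and, by the maximum principle, to [h x]. *)
  rewrite -(cvg_lim _ c)//; apply: cvg_lim => //.
  apply: cvg_substoch_iter.
  - by move=> y j; exact: measure_ge0.
  - by move=> y; exact: measure_ge0.
  - by move=> y; rewrite step_total.
  - by move=> y; rewrite b_E lte_fin mulr_gt0// exprn_gt0.
  - by move=> y; rewrite /h mulr_ge0 ?exprn_ge0 ?divr_ge0 ?subr_ge0// ltW.
  - move=> y; rewrite b_E.
    exact: (geometric_solution _ f N xi r).
  - apply: cvg_geometric; rewrite ger0_norm//; exact: ltW.
have pE : p = (q - r) / (1 - r).
  by rewrite /p; have := Ph 0%N; rewrite /h expr0 mulr1 => ->.
have qE' : 1 - (1 - p) * (1 - r) = q by rewrite pE; field.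
have s0E : s0 = q^-1 by rewrite /s0 qE'.
rewrite qE' s0E; split; last split.
- by rewrite pE ltr_pdivrMr ?subr_gt0// mul1r ltrD2r.
- by move=> x; rewrite Ph /h pE.
split; first by rewrite invf_gt1// q1 ltf_pV2.
have pgf := zsum_pgf_eq1 _ f N xi r r01 N_ge0 N_le1 N0 f_pos f_neg.
split; first by apply/pgf.
move=> s /andP[s1 sr] sE.
have s_gt0 : 0 < s := lt_trans ltr01 s1.
(* Inversion maps (1, 1/r) onto (r, 1), so uniqueness of q transfers to s. *)
have rs1 : r < s^-1 < 1.
  by rewrite invf_lt1// s1 -[r]invrK ltf_pV2 ?posrE ?invr_gt0// sr.
rewrite -[s]invrK; congr (_^-1).
apply: (tail_equation_uniq _ N N_ge0 N_le1 r (xi * r)) => //.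
  by rewrite N0 subr_gt0.
by apply/pgf => //; rewrite invrK.
Qed.
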